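(* Let $M$ be a finite $\mathscr R$-trivial monoid and $k$ a field. Fix for each $X\in\Lambda(M)$ an idempotent generator $e_X$. For $X,Y\in\Lambda(M)$ let $m_{X,Y}=|\{n\in\widetilde L_Y: e_Xn=n\}|$ and $c_{X,Y}=\dim_k\mathrm{Hom}_{kM}(P_X,P_Y)$. Then $c_{X,Y}=\sum_{Z\le X}m_{Z,Y}\,\mu(Z,X)$, where $\mu$ is the Möbius function of the lattice $\Lambda(M)$.
   Context: $M$ is $\mathscr R$-trivial if $mM=nM$ implies $m=n$. $\Lambda(M)$ is the set of ideals $MeM$, $e$ idempotent, ordered by inclusion (a lattice). $P_X$ is the projective cover of the one-dimensional simple module $S_X$ on which $m$ acts by $1$ if $X\subseteq Mm^\omega M$ ($m^\omega$ the idempotent power) and $0$ otherwise. Define $m\le_{\widetilde{\mathscr L}}n$ if for every idempotent $e$, $ne=n$ implies $me=m$; $\widetilde{\mathscr L}$ is the associated equivalence, and $\widetilde L_Y$ is the $\widetilde{\mathscr L}$-class of $e_Y$. *)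

(* Defs.v *)
From HB Require Import structures.
From mathcomp Require Import all_boot all_order all_algebra.
Set Implicit Arguments. Unset Strict Implicit. Unset Printing Implicit Defensive.
Import GRing.Theory.

HB.structure Definition FinMonoid := {M of Monoid M & Finite M}.

Section MonoidDefs.
Variable M : FinMonoid.type.
Local Open Scope group_scope.

Definition idem (e : M) : bool := e * e == e.

Definition rtrivial : Prop :=
  forall m n : M, [set m * x | x : M] = [set n * x | x : M] -> m = n.

Definition ideal2 (e : M) : {set M} := [set x * e * y | x : M, y : M].

Definition Lambda : {set {set M}} := [set ideal2 e | e : M & idem e].

(* m^omega : the idempotent positive power of m (unique in a finite monoid;
   it occurs among m^1, ..., m^|M|). *)
Definition omega (m : M) : M :=
  odflt 1 [pick e : M | idem e &&
     [exists i : 'I_(#|M|.+1), (0 < i)%N && (e == m ^+ i)]].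

Definition leLtil (m n : M) : bool :=
  [forall e : M, idem e ==> ((n * e == n) ==> (m * e == m))].
Definition eqLtil (m n : M) : bool := leLtil m n && leLtil n m.

Definition mXY (e : {set M} -> M) (X Y : {set M}) : nat :=
  #|[set n : M | eqLtil n (e Y) & e X * n == n]|.

(* Moebius function of the finite poset (L, subset), by the defining recursion
   mu(x,x) = 1, mu(x,y) = - sum_{x <= z < y} mu(x,z) for x < y, 0 otherwise.
   The fuel #|M|.+2 exceeds the length of any strict chain of subsets of M. *)
Fixpoint mobf (L : {set {set M}}) (n : nat) (x y : {set M}) : int :=
  match n with
  | 0 => 0%R
  | n'.+1 =>
    if x == y then 1%R
    else if x \proper y then
      (- \sum_(z in L | (x \subset z) && (z \proper y)) mobf L n' x z)%R
    else 0%R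
  end.
Definition mobius (L : {set {set M}}) (x y : {set M}) : int :=
  mobf L (#|M|.+2) x y.

(* Finite-dimensional left kM-modules: k^d (column vectors) with m acting by
   the matrix act m. *)
Variable k : fieldType.
Record fdmod := FDMod { fdim : nat; fact : M -> 'M[k]_fdim }.

Definition is_mod (V : fdmod) : Prop :=
  fact V 1 = (1%:M)%R /\ forall m n : M, fact V (m * n) = (fact V m *m fact V n)%R.

Definition is_hom (V W : fdmod) (F : 'M[k]_(fdim W, fdim V)) : Prop :=
  forall m : M, (F *m fact V m)%R = (fact W m *m F)%R.

Definition surj (V W : fdmod) (F : 'M[k]_(fdim W, fdim V)) : Prop :=
  \rank F = fdim W.

Definition projective (P : fdmod) : Prop :=
  is_mod P /\
  forall (V W : fdmod), is_mod V -> is_mod W ->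
  forall f : 'M[k]_(fdim W, fdim V), is_hom f -> surj f ->
  forall g : 'M[k]_(fdim W, fdim P), is_hom g ->
  exists h : 'M[k]_(fdim V, fdim P), is_hom h /\ (f *m h)%R = g.

Definition essential (P S : fdmod) (pi : 'M[k]_(fdim S, fdim P)) : Prop :=
  forall Q : fdmod, is_mod Q ->
  forall g : 'M[k]_(fdim P, fdim Q), is_hom g -> surj (pi *m g)%R -> surj g.

Definition proj_cover (S P : fdmod) : Prop :=
  projective P /\
  exists pi : 'M[k]_(fdim S, fdim P), [/\ is_hom pi, surj pi & essential pi].

Definition simpleS (X : {set M}) : fdmod :=
  @FDMod 1 (fun m => (if X \subset ideal2 (omega m) then 1 else 0)%:M%R).

Definition homdim (V W : fdmod) : nat :=
  \dim (lker (linfun (fun F : 'M[k]_(fdim W, fdim V) =>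
          [ffun m : M => (F *m fact V m - fact W m *m F)%R]))).

End MonoidDefs.

(* Main.v *)
Require Import Defs.
From HB Require Import structures.
From mathcomp Require Import all_boot all_order all_algebra.
Set Implicit Arguments. Unset Strict Implicit. Unset Printing Implicit Defensive.
Import GRing.Theory.

(** In an R-trivial monoid, X is contained in M m^w M iff e_X m = e_X, so every
    composition factor is one of the S_X.  A power of the product of the e - h,
    h ranging over the idempotents strictly below e = e_Y, gives an idempotent
    eps_Y of kM annihilated on the left by Me \ Ltilde_Y; hence the
    module k Ltilde_Y, on which m sends n to mn or to 0, is projective, with
    Hom(k Ltilde_Y, V) = eps_Y V, and it is the projective cover of S_Y.  Along a
    flag of V with one-dimensional quotients, e_X counts the factors S_Z with
    Z <= X and eps_Z those isomorphic to S_Z, so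
    rank e_X = sum_(Z <= X) dim Hom(P_Z, V).  For V = k Ltilde_Y the left-hand
    side is m_(X,Y), and Moebius inversion concludes. *)

(** * Moebius inversion over a family of finite sets ordered by inclusion *)

Section MoebiusInversion.
Local Open Scope ring_scope.
Variables (M : FinMonoid.type) (L : {set {set M}}).

(** Recursive calls only reach proper subsets of [y], so fuel above [#|y|] never runs out. *)
Lemma mobf_fuel n n' (x y : {set M}) :
  (#|y| < n)%N -> (#|y| < n')%N -> mobf L n x y = mobf L n' x y.
Proof.
elim: n n' y => [|n IHn] [|n'] y //= lt_yn lt_yn'.
case: eqP => // _; case: ifP => // _; congr (- _).
apply: eq_bigr => z /and3P[_ _ /proper_card lt_zy].
by apply: IHn; apply: leq_trans lt_zy _; rewrite -ltnS.
Qed.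

Lemma mobius_out (x y : {set M}) : ~~ (x \subset y) -> mobius L x y = 0.
Proof.
rewrite /mobius /=; case: eqP => [->|_]; first by rewrite subxx.
by rewrite properE => /negPf->.
Qed.

Lemma sum_mobius (x y : {set M}) : x \in L -> y \in L ->
  \sum_(z in L | z \subset y) mobius L x z = (x == y)%:R.
Proof.
move=> Lx Ly; have [sxy|nsxy] := boolP (x \subset y); last first.
  rewrite big1 => [|z /andP[_ szy]].
    by case: eqP nsxy => // ->; rewrite subxx.
  by apply: mobius_out; apply: contra nsxy => sxz; apply: subset_trans szy.
rewrite (bigD1 y) /=; last by rewrite Ly subxx.
have -> : \sum_(i | (i \in L) && (i \subset y) && (i != y)) mobius L x i
  = \sum_(z in L | (x \subset z) && (z \proper y)) mobius L x z.
  rewrite [LHS](bigID (fun z : {set M} => x \subset z)) /=.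
  rewrite [X in _ + X]big1 ?addr0 => [|z /andP[_]]; last exact: mobius_out.
  apply: eq_bigl => z; rewrite properEneq.
  by case: (z \in L); case: (x \subset z); case: (z \subset y); case: (z == y).
rewrite [mobius L x y]/mobius /=.
case: (x =P y) => [eq_xy|/eqP ne_xy].
  rewrite big1 ?addr0 // => z /and3P[_ sxz szy].
    by have := sub_proper_trans sxz szy; rewrite eq_xy properxx.
rewrite properEneq ne_xy sxy /=; apply/eqP; rewrite addrC subr_eq0; apply/eqP.
apply: eq_bigr => z /and3P[_ _ /proper_card lt_zy].
(* Unfolding [mobius] once left fuel [#|M|.+1] inside the sum. *)
by apply: (@mobf_fuel (#|M|.+2) (#|M|.+1)); rewrite ltnS ?leqW ?max_card.
Qed.

(* [sum_mobius] makes the Moebius matrix a left inverse of the zeta matrix; inversion uses that it is a right inverse. *)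
Lemma moebius_inversion (c g : {set M} -> int) :
    (forall X, X \in L -> g X = \sum_(Z in L | Z \subset X) c Z) ->
  forall X, X \in L ->
    c X = \sum_(Z in L | Z \subset X) g Z * mobius L Z X.
Proof.
move=> gE X LX.
pose v (i : 'I_#|L|) : {set M} := enum_val i.
pose zeta : 'M[int]_#|L| := \matrix_(i, j) (v i \subset v j)%:R.
pose mu : 'M[int]_#|L| := \matrix_(i, j) mobius L (v i) (v j).
have sumL (F : {set M} -> int) : \sum_(Z in L) F Z = \sum_i F (v i).
  by rewrite big_enum_val.
have mu_zeta : mu *m zeta = 1%:M.
  apply/matrixP => i j; rewrite !mxE.
  under eq_bigr do rewrite !mxE.
  rewrite -(sumL (fun Z => mobius L (v i) Z * (Z \subset v j)%:R)).
  transitivity (\sum_(z in L | z \subset v j) mobius L (v i) z).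
    by rewrite big_mkcondr; apply: eq_bigr => z _; case: ifP; rewrite ?mulr1 ?mulr0.
  by rewrite sum_mobius ?enum_valP // (inj_eq enum_val_inj).
pose cv : 'rV[int]_#|L| := \row_i c (v i).
pose gv : 'rV[int]_#|L| := \row_i g (v i).
have gvE : gv = cv *m zeta.
  apply/rowP => j; rewrite !mxE gE ?enum_valP //.
  under [RHS]eq_bigr do rewrite !mxE.
  rewrite -(sumL (fun Z => c Z * (Z \subset v j)%:R)) big_mkcondr.
  by apply: eq_bigr => z _; case: ifP; rewrite ?mulr1 ?mulr0.
have : cv = gv *m mu by rewrite gvE -mulmxA (mulmx1C mu_zeta) mulmx1.
move/rowP/(_ (enum_rank_in LX X)); rewrite !mxE /v enum_rankK_in // => ->.
under eq_bigr do rewrite !mxE /v enum_rankK_in //.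
rewrite -(sumL (fun Z => g Z * mobius L Z X)) big_mkcondr.
by apply: eq_bigr => z _; case: ifP => // /negbT/mobius_out->; rewrite mulr0.
Qed.

End MoebiusInversion.

(** * Idempotents, ideals and Ltilde-classes in an R-trivial monoid *)

Section RTrivialMonoid.
Local Open Scope group_scope.
Variables (M : FinMonoid.type) (HR : rtrivial M).
Implicit Types e f h m n : M.

(** Induction measure: by R-triviality, a right multiplication that changes [m] strictly shrinks
    mM. *)
Definition rsize m := #|[set m * x | x : M]|.

Lemma rsize_gt0 m : (0 < rsize m)%N.
Proof. by apply/card_gt0P; exists (m * 1); apply: imset_f. Qed.

Lemma rsize_max m : (rsize m <= #|M|)%N.
Proof. exact: max_card. Qed.

Lemma rideal_sub m n : [set (m * n) * x | x : M] \subset [set m * x | x : M].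
Proof.
by apply/subsetP=> _ /imsetP[x _ ->]; rewrite -mulgA; apply: imset_f.
Qed.

Lemma rsize_lt m n : m * n != m -> (rsize (m * n)%g < rsize m)%N.
Proof.
move=> ne_mn; apply: proper_card; rewrite properEneq rideal_sub andbT.
by apply: contra ne_mn => /eqP/HR->.
Qed.

(** The nested right ideals mM, mnM and mnpM = mM coincide. *)
Lemma mulg_rfix m n p : m * n * p = m -> m * n = m.
Proof.
move=> mnp; apply: HR; apply/eqP; rewrite eqEsubset rideal_sub /=.
by rewrite -{1}mnp rideal_sub.
Qed.

(** Makes m -> [fm = f] multiplicative: for idempotent [f] these are the characters of the simple
    modules. *)
Lemma eq_mulg_fixM f m n :
  (f * (m * n) == f) = (f * m == f) && (f * n == f).
Proof.
apply/eqP/andP=> [|[/eqP fm /eqP fn]]; last by rewrite mulgA fm fn.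
rewrite mulgA => fmn; have fm := mulg_rfix fmn.
by move: fmn; rewrite fm => fn; split; apply/eqP.
Qed.

Lemma mulg_expfix m n i : m * n = m -> m * n ^+ i = m.
Proof.
by move=> mn; elim: i => [|i IHi]; rewrite ?mulg1 // expgSr mulgA IHi.
Qed.

Lemma omegaP m : idem (omega m) /\ exists i, omega m = m ^+ i.+1.
Proof.
rewrite /omega; case: pickP => [e /andP[ide /existsP[[[//|i] lti]]]|none].
  by case/andP=> _ /eqP em; split=> //; exists i.
(* By pigeonhole two of the powers [m ^+ 0], ..., [m ^+ #|M|] agree, and [mulg_rfix] makes the
   powers stationary. The stable power is idempotent and within the range searched by [omega], so
   the default [1] is never returned. *)
have [i lei mi] : exists2 i, (i < #|M|)%N & m ^+ i.+1 * m = m ^+ i.+1.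
  have : ~~ injectiveb (fun i : 'I_#|M|.+1 => m ^+ i).
    apply/injectiveP=> /leq_card; apply/negP.
    by rewrite -ltnNge card_ord.
  case/injectivePn=> i [j].
  wlog lt_ij : i j / (i < j)%N => [hw neij eij|_ eij].
    have [/hw||/val_inj/eqP] := ltngtP i j; [exact| |by rewrite (negPf neij)].
    by move/hw; apply; rewrite // eq_sym.
  have mi : m ^+ i * m = m ^+ i.
    apply: (@mulg_rfix _ _ (m ^+ (j - i.+1))).
    by rewrite -expgSr -expgnDr subnKC.
  exists i; first exact: leq_trans lt_ij (leq_ord j).
  by rewrite expgSr mi.
have := none (m ^+ i.+1); rewrite /idem mulg_expfix // eqxx /=.
by move/existsP; case; exists (Ordinal (lei : (i.+1 < #|M|.+1)%N)) => /=.
Qed.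

Lemma omega_idem m : idem (omega m). Proof. by case: (omegaP m). Qed.

Lemma omega_fix m n : n * m = n -> n * omega m = n.
Proof. by case: (omegaP m) => _ [i ->]; apply: mulg_expfix. Qed.

Lemma fix_omega m n : n * omega m = n -> n * m = n.
Proof.
by case: (omegaP m) => _ [i ->]; rewrite expgS mulgA; apply: mulg_rfix.
Qed.

(** If e = xfy then e = exfy; [mulg_rfix] gives ex = e, hence efy = e, and then ef = e. *)
Lemma ideal2_sub e f : idem e -> (ideal2 e \subset ideal2 f) = (e * f == e).
Proof.
move=> /eqP ide; apply/idP/eqP=> [/subsetP/(_ e)|ef].
  case/(_ _)/imset2P => [|x y _ _ exfy].
    by apply/imset2P; exists 1 1; rewrite // mul1g mulg1.
  have ex : e * x = e.
    by apply: (@mulg_rfix _ _ (f * y)); rewrite -mulgA (mulgA x) -exfy.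
  by apply: (@mulg_rfix _ _ y); rewrite -{1}ex -!mulgA (mulgA x) -exfy.
apply/subsetP=> _ /imset2P[x y _ _ ->]; apply/imset2P.
by exists (x * e) y; rewrite // -(mulgA x e f) ef.
Qed.

(** Identifies the action on S_X, for X = MeM, with the character m -> [em = e]. *)
Lemma sub_ideal2_omega e m :
  idem e -> (ideal2 e \subset ideal2 (omega m)) = (e * m == e).
Proof.
move=> ide; rewrite ideal2_sub //.
by apply/eqP/eqP; [apply: fix_omega|apply: omega_fix].
Qed.

Definition Lcls e : {set M} := [set n | eqLtil n e].

Definition below e : seq M :=
  [seq h <- enum M | [&& idem h, h != e, e * h == h & h * e == h]].

Lemma belowP e h : h \in below e -> [/\ idem h, h != e, e * h = h & h * e = h].
Proof. by rewrite mem_filter => /andP[/and4P[? ? /eqP ? /eqP ?] _]. Qed.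

Lemma Lcls_fix e n : idem e -> n \in Lcls e -> n * e = n.
Proof.
move=> ide; rewrite inE => /andP[/forallP/(_ e)]; rewrite ide (eqP ide) eqxx /=.
by move/eqP.
Qed.

Lemma Lcls_fixP e n f : n \in Lcls e -> idem f -> n * f = n -> e * f = e.
Proof.
by rewrite inE => /andP[_ /forallP/(_ f)] + idf nf; rewrite idf nf eqxx => /eqP.
Qed.

(** The class is defined by testing idempotents; the idempotent power of [u] extends the test to all
    elements. *)
Lemma Lcls_fix_any e n u : n \in Lcls e -> n * u = n -> e * u = e.
Proof.
move=> Ln nu; apply: fix_omega; apply: (Lcls_fixP Ln (omega_idem u)).
exact: omega_fix.
Qed.

(** As ne = n, only an idempotent f with nf = n and ef != e can exclude n from the class. Then h =
    (efe)^omega fixes n and lies under e; h = e would force ef = e by [mulg_rfix]. *)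
Lemma Lcls_out e n : idem e -> n * e = n -> n \notin Lcls e ->
  exists2 h, h \in below e & n * h = n.
Proof.
move=> ide ne; rewrite inE negb_and => /orP[] /forallPn[f];
  rewrite !negb_imply => /and3P[idf /eqP].
  by move=> ef; rewrite -ne -mulgA ef eqxx.
move=> nf ef; pose h := omega (e * f * e).
have hE : exists z, h = e * f * e * z /\ exists z, h = z * (e * f * e).
  have [_ [i hi]] := omegaP (e * f * e).
  exists ((e * f * e) ^+ i); split; first by rewrite /h hi expgS.
  by exists ((e * f * e) ^+ i); rewrite /h hi expgSr.
case: hE => z [hz [z' hz']].
exists h; last by apply: omega_fix; rewrite !mulgA ne nf ne.
rewrite mem_filter mem_enum inE andbT omega_idem.
apply/and4P; split=> //.
- apply: contra ef => /eqP he; apply/eqP; apply: (@mulg_rfix _ _ (e * z)).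
  by rewrite mulgA -hz he.
- by rewrite hz !mulgA (eqP ide).
- by rewrite hz' -!mulgA (eqP ide).
Qed.

Lemma below_notin_Lcls e h : h \in below e -> h \notin Lcls e.
Proof.
case/belowP=> /eqP idh ne_h eh _; apply: contra ne_h => Lh.
by rewrite -{1}eh (Lcls_fixP Lh) // /idem idh.
Qed.

(** An [h] below [e] that fixes [n] on the right also fixes mn. Thus Me \ Ltilde spans a submodule
    of kMe, with quotient k Ltilde. *)
Lemma notin_Lcls_mul e m n :
  idem e -> n * e = n -> n \notin Lcls e -> m * n \notin Lcls e.
Proof.
move=> ide ne nL; have [h hb nh] := Lcls_out ide ne nL.
have [idh ne_h eh _] := belowP hb.
apply: contra ne_h => Lmn.
by rewrite -eh (Lcls_fixP Lmn idh) // -mulgA nh.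
Qed.

Local Open Scope ring_scope.

(** * The idempotents [eps] and their values in one-dimensional characters *)

Section RadicalIdempotent.
Variables (A : pzRingType) (rho : M -> A).
Hypothesis rhoM : forall m n, rho (m * n)%g = rho m * rho n.
Variable e : M.

(* [eps] is the primitive idempotent of kM attached to e, evaluated in a
   representation.  Multiplying an element of Me \ Ltilde(e) by [epsT] on the
   right leaves a combination of strictly R-smaller elements of Me \ Ltilde(e),
   so the power #|M| kills it. *)
Definition epsT : A := \prod_(h <- below e) (rho e - rho h).
Definition eps : A := rho e * epsT ^+ #|M|.

Hypothesis ide : idem e.

Let rhoX n : (n * e)%g = n -> rho n * eps = rho n * epsT ^+ #|M|.
Proof. by move=> ne; rewrite /eps mulrA -rhoM ne. Qed.

Lemma rho_eps_out n : (n * e)%g = n -> n \notin Lcls e -> rho n * eps = 0.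
Proof.
move=> ne nL; rewrite rhoX //.
suff kill N : forall n, (n * e)%g = n -> n \notin Lcls e ->
    (rsize n <= N)%N -> rho n * epsT ^+ N = 0 by apply: kill (rsize_max n).
elim: N {n ne nL} => [|N IHN] n ne nL.
  by rewrite leqNgt rsize_gt0.
move=> leN; rewrite exprS mulrA.
(* Multiplying out partial products of [epsT] never raises [rsize], so the induction hypothesis on
   [N] still kills every resulting term. *)
have low s : {subset s <= below e} -> forall n, (n * e)%g = n -> n \notin Lcls e ->
    (rsize n <= N)%N -> rho n * \prod_(h <- s) (rho e - rho h) * epsT ^+ N = 0.
  elim: s => [|h s IHs] sb p pe pL leP; first by rewrite big_nil mulr1 IHN.
  have hb : h \in below e by rewrite sb ?mem_head.
  have sb' : {subset s <= below e} by move=> x xs; rewrite sb // inE xs orbT.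
  have [idh _ eh he] := belowP hb.
  rewrite big_cons mulrA mulrBr -!rhoM pe !mulrBl IHs // sub0r IHs ?oppr0 //.
  - by rewrite -mulgA he.
  - by apply: (@notin_Lcls_mul _ p) => //; exact: below_notin_Lcls.
  apply: leq_trans leP; case: (eqVneq (p * h)%g p) => [->//|/rsize_lt].
  exact: ltnW.
(* The first factor whose [h] fixes [n], at the latest [h0], annihilates [rho n]; each earlier
   factor adds a term in nh, of smaller [rsize], which [low] kills. *)
have [h0 h0b nh0] := Lcls_out ide ne nL.
suff : forall s, {subset s <= below e} -> h0 \in s ->
  rho n * \prod_(h <- s) (rho e - rho h) * epsT ^+ N = 0 by apply.
elim=> [//|h s IHs] sb h0s.
have hb : h \in below e by rewrite sb ?mem_head.
have sb' : {subset s <= below e} by move=> x xs; rewrite sb // inE xs orbT.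
have [idh _ eh he] := belowP hb.
rewrite big_cons mulrA mulrBr -!rhoM ne.
have [->|nh] := eqVneq (n * h)%g n; first by rewrite subrr !mul0r.
rewrite !mulrBl IHs // ?sub0r ?low ?oppr0 //.
- by rewrite -mulgA he.
- by apply: (@notin_Lcls_mul _ n) => //; exact: below_notin_Lcls.
- by rewrite -ltnS (leq_trans (rsize_lt nh)).
by move: h0s; rewrite inE; case: eqP => // h0h; rewrite -h0h nh0 eqxx in nh.
Qed.

(** Each [h] below [e] is outside the class, so [rho h * eps = 0] while [rho e * eps = eps]: every
    factor of [epsT] fixes [eps]. *)
Lemma eps_idem : eps * eps = eps.
Proof.
have ee : rho e * eps = eps by rewrite /eps mulrA -rhoM (eqP ide).
have Teps : epsT * eps = eps.
  rewrite /epsT; have : {subset below e <= below e} by [].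
  elim: {-2}(below e) => [|h s IHs] sb; first by rewrite big_nil mul1r.
  rewrite big_cons -mulrA IHs => [|x xs]; last by rewrite sb // inE xs orbT.
  have hb : h \in below e by rewrite sb ?mem_head.
  have [_ _ _ he] := belowP hb.
  by rewrite mulrBl ee rho_eps_out ?subr0 // below_notin_Lcls.
rewrite {1}/eps -mulrA; suff -> : epsT ^+ #|M| * eps = eps by [].
by elim: #|M| => [|N IHN]; rewrite ?mul1r // exprS -mulrA IHN.
Qed.

End RadicalIdempotent.

(** If fe != f the leading factor vanishes. If [f] is in Me but outside the class, [rho_eps_out]
    applies, since f acts as 1. If [f] is in the class, every [h] below [e] acts as 0. *)
Lemma eps_char (A : pzRingType) e f :
  idem e -> idem f ->
  eps (fun m => ((f * m)%g == f)%:R : A) e = (ideal2 f == ideal2 e)%:R.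
Proof.
move=> ide idf; set chi := fun m => _.
have chiM m n : chi (m * n)%g = chi m * chi n.
  by rewrite /chi -natrM mulnb eq_mulg_fixM.
have chif : chi f = 1 by rewrite /chi (eqP idf) eqxx.
have [fe|fe] := eqVneq (f * e)%g f; last first.
  rewrite /eps {1}/chi (negPf fe) mul0r; case: eqP => // fe'.
  by rewrite -(ideal2_sub _ idf) fe' subxx in fe.
have [fL|fL] := boolP (f \in Lcls e); last first.
  rewrite -[LHS]mul1r -chif rho_eps_out //; case: eqP => // fe'.
  have [h hb fh] := Lcls_out ide fe fL; have [idh ne_h eh _] := belowP hb.
  move: (ideal2_sub h idf); rewrite fh eqxx fe' ideal2_sub // eh => /eqP he.
  by rewrite he eqxx in ne_h.
have ef : (e * f)%g = e by apply: Lcls_fixP fL idf (eqP idf).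
have -> : ideal2 f == ideal2 e.
  by rewrite eqEsubset !ideal2_sub // fe ef !eqxx.
have chie : chi e = 1 by rewrite /chi fe eqxx.
rewrite /eps chie mul1r /epsT big_seq big1 ?expr1n // => h hb.
have [idh ne_h eh he] := belowP hb.
rewrite chie /chi; case: eqP => [fh|]; last by rewrite subr0.
by rewrite -eh -ef -mulgA fh ef eqxx in ne_h.
Qed.

End RTrivialMonoid.

(** * Counting composition factors by ranks of idempotents *)

Section Representations.
Local Open Scope ring_scope.
Variables (M : FinMonoid.type) (HR : rtrivial M) (k : fieldType).

Lemma mulE n (A B : 'M[k]_n) : A * B = A *m B. Proof. by []. Qed.

Lemma eps_intertwine p q (rho : M -> 'M[k]_p) (sig : M -> 'M[k]_q)
    (F : 'M[k]_(q, p)) (e : M) :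
  (forall m, F *m rho m = sig m *m F) -> F *m eps rho e = eps sig e *m F.
Proof.
move=> hF.
have hT : F *m epsT rho e = epsT sig e *m F.
  rewrite /epsT; elim: (below e) => [|h s IHs].
    by rewrite !big_nil mulmx1 mul1mx.
  rewrite !big_cons !mulE mulmxA mulmxBr !hF -mulmxBl -mulmxA IHs.
  by rewrite mulmxA.
have hX i : F *m (epsT rho e) ^+ i = (epsT sig e) ^+ i *m F.
  elim: i => [|i IHi]; first by rewrite !expr0 mulmx1 mul1mx.
  by rewrite !exprS !mulE mulmxA hT -mulmxA IHi mulmxA.
by rewrite /eps !mulE mulmxA hF -mulmxA hX mulmxA.
Qed.

(* An idempotent block-triangular matrix is conjugate to its diagonal part. *)
Lemma rank_idem_block p q (a : 'M[k]_p) (c : 'M[k]_(q, p)) (D : 'M[k]_q) :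
  let E := block_mx a 0 c D in E *m E = E -> \rank E = (\rank a + \rank D)%N.
Proof.
move=> E; rewrite mulmx_block !mul0mx !mulmx0 !addr0 add0r.
case/eq_block_mx => aa _ cc DD.
have Dca : D *m c *m a = 0.
  by have := congr1 (mulmx D) cc; rewrite mulmxDr !mulmxA DD -[RHS]add0r => /addIr.
pose x := D *m c - c *m a.
have U y : block_mx 1%:M 0 y 1%:M *m block_mx 1%:M 0 (- y) 1%:M = 1%:M :> 'M[k]_(p + q).
  rewrite mulmx_block !mulmx1 !mul1mx !mul0mx !mulmx0 !addr0 !add0r.
  by rewrite subrr -scalar_mx_block.
have UX : block_mx 1%:M 0 x 1%:M *m E *m block_mx 1%:M 0 (- x) 1%:M
    = block_mx a 0 0 D.
  rewrite !mulmx_block !mulmx1 !mul1mx !mul0mx !mulmx0 !addr0 !add0r.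
  have xa : x *m a = - (c *m a) by rewrite mulmxBl Dca sub0r -mulmxA aa.
  have Dx : D *m x = D *m c by rewrite mulmxBr !mulmxA DD Dca subr0.
  by rewrite mul0mx addr0 xa mulmxN Dx -{2}cc addKr subrr.
have ux y : (block_mx 1%:M 0 y 1%:M : 'M[k]_(p + q)) \in unitmx.
  by have /mulmx1_unit[] := U y.
rewrite -rank_diag_block_mx -UX mxrankMfree ?row_free_unit ?ux //.
rewrite -(mxrank_tr (_ *m E)) trmx_mul mxrankMfree ?mxrank_tr //.
by rewrite row_free_unit unitmx_tr ux.
Qed.

(** The intertwining hypotheses say that [E] is block lower triangular with diagonal blocks [a]
    (quotient) and [D] (submodule). *)
Lemma rank_idem_ext p q (E : 'M[k]_(p + q)) (a : 'M[k]_p) (D : 'M[k]_q) :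
    E *m E = E -> row_mx 1%:M 0 *m E = a *m row_mx 1%:M 0 ->
    E *m col_mx 0 1%:M = col_mx 0 1%:M *m D ->
  \rank E = (\rank a + \rank D)%N.
Proof.
rewrite -(submxK E); set ul := ulsubmx E; set c := dlsubmx E.
move=> EE; rewrite mul_row_block mul_mx_row !mul1mx !mul0mx !addr0 mulmx1 mulmx0.
case/eq_row_mx => eul eur; move: EE; rewrite eul eur => EE.
rewrite mul_block_col mul_col_mx !mulmx0 !mulmx1 !add0r mul0mx mul1mx.
by case/eq_col_mx => _ edr; move: EE; rewrite edr; apply: rank_idem_block.
Qed.

(** Take a nonzero [rho m0] with [rsize m0] minimal: if m0 m != m0 then [rho (m0 * m)] is zero, so
    any nonzero row is a common eigenvector. An [f] of least [rsize] with m0 f = m0 absorbs on its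
    right every n fixing m0, itself included. *)
Lemma row_eigenvector d (rho : M -> 'M[k]_d) :
    (0 < d)%N -> rho 1%g = 1%:M ->
    (forall m n, rho (m * n)%g = rho m *m rho n) ->
  exists phi : 'rV[k]_d, phi != 0 /\
    exists2 f, idem f & forall m, phi *m rho m = (f * m == f)%g%:R *: phi.
Proof.
move=> d_gt0 rho1 rhoM.
have nz1 : rho 1%g != 0.
  rewrite rho1; apply/eqP=> /(congr1 (@mxrank _ _ _)).
  by rewrite mxrank1 mxrank0 => d0; rewrite d0 in d_gt0.
case: (arg_minnP (P := fun m => rho m != 0) (@rsize M) nz1) => m0 nz0 min0.
have [i nzi] : exists i, row i (rho m0) != 0.
  apply/existsP; apply: contraNT nz0 => /existsPn z.
  by apply/eqP/row_matrixP=> i; rewrite row0; apply/eqP; rewrite -[_ == _]negbK z.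
have st1 : (m0 * 1 == m0)%g by rewrite mulg1.
case: (arg_minnP (P := fun n => m0 * n == m0)%g (@rsize M) st1) => f /eqP m0f minf.
have ffix n : (m0 * n = m0)%g -> (f * n = f)%g.
  move=> m0n; apply/eqP; apply/negPn/negP => /(rsize_lt HR).
  by rewrite ltnNge minf // mulgA m0f m0n.
exists (row i (rho m0)); split=> //; exists f; first by rewrite /idem ffix.
move=> m; rewrite -row_mul -rhoM.
have -> : ((f * m == f) = (m0 * m == m0))%g.
  apply/eqP/eqP=> [fm|/ffix //]; by rewrite -m0f -mulgA fm.
have [->|ne] := eqVneq; first by rewrite scale1r.
rewrite scale0r; apply/eqP; rewrite -[_ == _]negbK.
have [->|nz] := eqVneq (rho (m0 * m)%g) 0; first by rewrite row0 eqxx.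
by have := min0 _ nz; rewrite leqNgt (rsize_lt HR).
Qed.

Variable e : {set M} -> M.
Hypothesis He : forall X, X \in Lambda M -> idem (e X) /\ ideal2 (e X) = X.

(* rho(e_X) has rank the number of composition factors S_Z with Z <= X, and
   eps(e_Z) the multiplicity of S_Z: both are additive along a flag of
   submodules with one-dimensional quotients. *)
Lemma rank_eps_sum d (rho : M -> 'M[k]_d) (X : {set M}) :
    rho 1%g = 1%:M -> (forall m n, rho (m * n)%g = rho m *m rho n) ->
    X \in Lambda M ->
  \rank (rho (e X)) = (\sum_(Z in Lambda M | Z \subset X) \rank (eps rho (e Z)))%N.
Proof.
move=> rho1 rhoM LX; elim: d rho rho1 rhoM => [|d IHd] rho rho1 rhoM.
  rewrite [rho _]flatmx0 mxrank0 big1 // => Z _.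
  by rewrite [eps _ _]flatmx0 mxrank0.
have [//|phi [nz [f idf hphi]]] := row_eigenvector _ rho1 rhoM.
change 'M[k]_(1 + d) with 'M[k]_d.+1 in rho, rho1, rhoM, hphi.
have rphi : \rank phi = 1%N by rewrite rank_rV nz.
(* Base change making [phi] a multiple of the first coordinate; its kernel, a submodule, becomes the
   last [d] coordinates, with action [D]. *)
pose A : 'M[k]_(1 + d) := row_ebase phi.
have uA : A \in unitmx by apply: row_ebase_unit.
pose p1 : 'M[k]_(1, 1 + d) := row_mx 1%:M 0.
pose s m : 'M[k]_1 := (f * m == f)%g%:R.
have hp m : p1 *m A *m rho m = s m *m (p1 *m A).
  have -> : p1 *m A = invmx (col_ebase phi) *m phi.
    rewrite -{2}[phi]mulmx_ebase rphi -!mulmxA mulKmx ?col_ebase_unit //.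
    by rewrite /p1 -pid_mx_row.
  rewrite -mulmxA hphi -scalemxAr /s.
  by case: eqP => _; rewrite ?scale1r ?scale0r ?mul1mx ?mul0mx.
pose B m := A *m rho m *m invmx A.
have hAB m : A *m rho m = B m *m A by rewrite /B mulmxKV.
have B1 : B 1%g = 1%:M by rewrite /B rho1 mulmx1 mulmxV.
have BM m n : B (m * n)%g = B m *m B n.
  by rewrite /B rhoM !mulmxA mulmxKV.
have hpB m : p1 *m B m = s m *m p1.
  by rewrite /B !mulmxA hp -!mulmxA mulmxV // mulmx1.
pose D m := drsubmx (B m).
pose K : 'M[k]_(1 + d, d) := col_mx 0 1%:M.
have hBb m : B m = block_mx (s m) 0 (dlsubmx (B m)) (D m).
  have := hpB m; rewrite -{1 2}(submxK (B m)) /p1 mul_row_block mul_mx_row.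
  rewrite !mul1mx !mul0mx !addr0 mulmx1 mulmx0.
  by case/eq_row_mx => -> ->.
have hK m : B m *m K = K *m D m.
  by rewrite hBb /K mul_block_col mul_col_mx !mulmx0 !mulmx1 !add0r mul0mx mul1mx.
have D1 : D 1%g = 1%:M by rewrite /D B1 scalar_mx_block block_mxKdr.
have DM m n : D (m * n)%g = D m *m D n.
  rewrite {1}/D BM (hBb m) (hBb n) mulmx_block block_mxKdr.
  by rewrite mulmx0 add0r.
have sM m n : s (m * n)%g = s m *m s n.
  by rewrite /s mulmxE -natrM mulnb (eq_mulg_fixM HR).
have rankAB E F : A *m E = F *m A -> \rank E = \rank F.
  move=> AE; have rF : row_free A by rewrite row_free_unit.
  rewrite -(mxrankMfree F rF) -AE -mxrank_tr -[RHS]mxrank_tr trmx_mul.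
  by rewrite mxrankMfree // row_free_unit unitmx_tr.
have [ideX eXX] := He LX.
rewrite (rankAB _ _ (hAB (e X))) (@rank_idem_ext _ _ _ (s (e X)) (D (e X))) //; last first.
  by rewrite -BM (eqP ideX).
rewrite (IHd D D1 DM).
(* The one-dimensional quotient, with the character of [f], contributes only at Z = MfM. *)
transitivity (\sum_(Z in Lambda M | Z \subset X)
   ((ideal2 f == Z) + \rank (eps D (e Z))))%N; last first.
  apply: eq_bigr => Z /andP[LZ _]; have [ideZ eZZ] := He LZ.
  rewrite (rankAB _ _ (eps_intertwine (e Z) hAB)).
  rewrite (@rank_idem_ext _ _ _ (eps s (e Z)) (eps D (e Z))).
  - rewrite eps_char // eZZ; congr (_ + _)%N.
    by case: (_ == _); rewrite ?mxrank0 ?mxrank1.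
  - by rewrite mulmxE eps_idem.
  - by apply: eps_intertwine.
  - by apply/esym; apply: eps_intertwine => m; rewrite hK.
rewrite big_split /=; congr (_ + _)%N.
have Lf : ideal2 f \in Lambda M by apply: imset_f; rewrite inE.
rewrite /s -(ideal2_sub HR _ idf) eXX.
have [sfX|nsfX] := boolP (ideal2 f \subset X).
  rewrite (bigD1 (ideal2 f)) /=; last by rewrite Lf.
  rewrite eqxx big1 ?mxrank1 // => Z /andP[_]; rewrite eq_sym.
  by move/negPf->.
rewrite mxrank0 big1 // => Z /andP[_ sZX].
by case: eqP => // fZ; rewrite fZ sZX in nsfX.
Qed.

End Representations.

Lemma eq_col (R : Type) p q (A B : 'M[R]_(p, q)) :
  (forall j, col j A = col j B) -> A = B.
Proof. by move=> AB; apply: trmx_inj; apply/row_matrixP=> j; rewrite -!tr_col AB. Qed.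

Lemma col_mulmx (k : fieldType) m n p (A : 'M[k]_(m, n)) (B : 'M[k]_(n, p)) j :
  (col j (A *m B) = A *m col j B)%R.
Proof. by rewrite !colE mulmxA. Qed.

Lemma mulmx_col_base_idem (k : fieldType) n (E : 'M[k]_n) :
  (E *m E = E -> E *m col_base E = col_base E)%R.
Proof.
move=> EE; apply: (row_free_inj (row_base_free E)).
by rewrite /= -mulmxA mulmx_base.
Qed.

(** * Hom spaces and uniqueness of projective covers *)

Section HomSpaces.
Local Open Scope ring_scope.
Variables (M : FinMonoid.type) (k : fieldType).
Implicit Types U V W P Q S : fdmod M k.

(** The map inside [homdim], named so that it can carry a linear structure. *)
Definition hom_defect V W (F : 'M[k]_(fdim W, fdim V)) :=
  [ffun m : M => F *m fact V m - fact W m *m F].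

Lemma hom_defect_linear V W : linear (@hom_defect V W).
Proof.
move=> a F G; apply/ffunP=> m; rewrite !ffunE mulmxDl mulmxDr.
by rewrite -!scalemxAl -!scalemxAr scalerBr opprD addrACA.
Qed.

HB.instance Definition _ V W := GRing.isLinear.Build k _ _ _
  (@hom_defect V W) (@hom_defect_linear V W).

Definition homsp V W := lker (linfun (@hom_defect V W)).

Lemma homspP V W (F : 'M[k]_(fdim W, fdim V)) :
  reflect (@is_hom M k V W F) (F \in homsp V W).
Proof.
rewrite memv_ker lfunE; apply: (iffP eqP) => [/ffunP h m|h].
  by have := h m; rewrite !ffunE => /eqP; rewrite subr_eq0 => /eqP.
by apply/ffunP=> m; rewrite !ffunE h subrr.
Qed.

Lemma lin_dim_le (aT rT : vectType k) (f : {linear aT -> rT})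
    (A : {vspace aT}) (B : {vspace rT}) :
    (forall u, u \in A -> f u \in B) ->
    (forall u, u \in A -> f u = 0 -> u = 0) ->
  (\dim A <= \dim B)%N.
Proof.
move=> fAB finj; rewrite -(@limg_dim_eq _ _ _ (linfun f) A).
  by apply: dimvS; apply/subvP=> _ /memv_imgP[u uA ->]; rewrite lfunE fAB.
apply/eqP; rewrite -subv0; apply/subvP=> u; rewrite memv_cap memv_ker lfunE memv0.
by case/andP=> uA /eqP/(finj _ uA)->.
Qed.

Lemma hom_comp U V W F G : @is_hom M k V W F -> @is_hom M k U V G ->
  @is_hom M k U W (F *m G).
Proof. by move=> hF hG m; rewrite -mulmxA hG !mulmxA hF. Qed.

Lemma homdim_le V V' W (h : 'M[k]_(fdim V, fdim V')) (s : 'M[k]_(fdim V', fdim V)) :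
  is_hom h -> h *m s = 1%:M -> (homdim V W <= homdim V' W)%N.
Proof.
move=> hh hs; apply: (@lin_dim_le _ _ (mulmxr h) (homsp V W) (homsp V' W)).
  by move=> F /homspP hF; apply/homspP; apply: hom_comp hF hh.
by move=> F _ /= Fh; rewrite -[F]mulmx1 -hs mulmxA Fh mul0mx.
Qed.

Lemma rank_fact_le V W (h : 'M[k]_(fdim V, fdim W)) (s : 'M[k]_(fdim W, fdim V)) m :
  is_hom h -> h *m s = 1%:M -> (\rank (fact V m) <= \rank (fact W m))%N.
Proof.
move=> hh hs; rewrite -[fact V m]mulmx1 -hs mulmxA -hh.
by rewrite (leq_trans (mxrankM_maxl _ _)) ?mxrankM_maxr.
Qed.

(** Lift q through p to h, which is onto because p is essential. Projectivity of P gives a section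
    s; as q s = p is onto, essentiality of q makes s onto, hence inverse to h. *)
Lemma proj_cover_iso S P Q : proj_cover S P -> proj_cover S Q ->
  exists (h : 'M[k]_(fdim P, fdim Q)) (s : 'M[k]_(fdim Q, fdim P)),
    [/\ is_hom h, is_hom s, h *m s = 1%:M & s *m h = 1%:M].
Proof.
move=> [[modP projP] [p [homp surjp essp]]] [[modQ projQ] [q [homq surjq essq]]].
(* The module laws descend to S along the surjection p. *)
have modS : is_mod S.
  have [B pB] : exists B, p *m B = 1%:M by apply/row_freeP; rewrite /row_free surjp.
  have fS m : fact S m = p *m fact P m *m B by rewrite homp -mulmxA pB mulmx1.
  split=> [|m n]; first by rewrite fS (proj1 modP) mulmx1.
  by rewrite (fS (m * n)%g) (proj2 modP) mulmxA homp -(mulmxA _ p) homp mulmxA -mulmxA pB mulmx1.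
have [h [homh ph]] := projQ _ _ modP modS p homp surjp q homq.
have surjh : surj h by apply: essp => //; rewrite ph.
have hom1 : @is_hom M k P P 1%:M by move=> m; rewrite mul1mx mulmx1.
have [s [homs hs]] := projP _ _ modQ modP h homh surjh _ hom1.
have surjs : surj s by apply: essq => //; rewrite -ph -mulmxA hs mulmx1.
exists h, s; split=> //.
have [B sB] : exists B, s *m B = 1%:M by apply/row_freeP; rewrite /row_free surjs.
by rewrite -[h]mulmx1 -sB !mulmxA -(mulmxA s) hs mulmx1.
Qed.

End HomSpaces.

(** * The module k Ltilde as projective cover of a simple module *)

Section LtildeModule.
Local Open Scope ring_scope.
Variables (M : FinMonoid.type) (HR : rtrivial M) (k : fieldType).
Variables (e : M) (ide : idem e).

Local Notation N := #|Lcls e|.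

Definition Lmod : fdmod M k := @FDMod M k N
  (fun m => \matrix_(i, j) (enum_val i == (m * enum_val j)%g)%:R).

(** Image of [n] in the quotient of kMe; its value 0 outside the class lets [Lmod_lvec] hold on all
    of Me. *)
Definition lvec n : 'cV[k]_N := \col_i (enum_val i == n)%:R.

Lemma lvec_out n : n \notin Lcls e -> lvec n = 0.
Proof.
move=> nL; apply/colP=> i; rewrite !mxE; case: eqP => // iE.
by rewrite -iE enum_valP in nL.
Qed.

Lemma mulmx_lvec p (A : 'M[k]_(p, N)) j : A *m lvec (enum_val j) = col j A.
Proof.
rewrite colE; congr (_ *m _); apply/colP=> i; rewrite !mxE andbT.
by rewrite (inj_eq enum_val_inj).
Qed.

Lemma lvec_ext p (A B : 'M[k]_(p, N)) :
  (forall n, n \in Lcls e -> A *m lvec n = B *m lvec n) -> A = B.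
Proof.
move=> AB; apply: eq_col => j; rewrite -!mulmx_lvec; apply: AB.
exact: enum_valP.
Qed.

Lemma lvec_sum (v : 'cV[k]_N) : v = \sum_i v i 0 *: lvec (enum_val i).
Proof.
apply/colP=> i; rewrite summxE (bigD1 i) //= !mxE eqxx mulr1 big1 ?addr0 // => j.
by rewrite !mxE (inj_eq enum_val_inj) eq_sym => /negPf->; rewrite mulr0.
Qed.

Lemma Lmod_lvec m n : (n * e)%g = n -> fact Lmod m *m lvec n = lvec (m * n)%g.
Proof.
move=> ne; have [nL|nL] := boolP (n \in Lcls e); last first.
  by rewrite !lvec_out ?mulmx0 // (notin_Lcls_mul HR).
rewrite -{1}(enum_rankK_in nL nL) mulmx_lvec; apply/colP=> i; rewrite !mxE.
by rewrite enum_rankK_in.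
Qed.

Lemma mulg_fixl m n : (n * e)%g = n -> (m * n * e)%g = (m * n)%g.
Proof. by move=> ne; rewrite -mulgA ne. Qed.

Lemma Lmod_is_mod : is_mod Lmod.
Proof.
split=> [|m n]; apply: lvec_ext => p /(Lcls_fix ide) pe.
  by rewrite Lmod_lvec // mul1g mul1mx.
by rewrite -mulmxA !Lmod_lvec ?mulg_fixl // mulgA.
Qed.

(** An [h] below [e] sends the generator to [lvec h], which is 0, so each factor of [epsT] fixes
    it. *)
Lemma eps_lvec : eps (fact Lmod) e *m lvec e = lvec e.
Proof.
have ee := eqP ide.
have hT : epsT (fact Lmod) e *m lvec e = lvec e.
  rewrite /epsT; have : {subset below e <= below e} by [].
  elim: {-2}(below e) => [|h s IHs] sb; first by rewrite big_nil mul1mx.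
  rewrite big_cons mulE -mulmxA IHs => [|x xs]; last by rewrite sb // inE xs orbT.
  have hb : h \in below e by rewrite sb ?mem_head.
  have [_ _ _ he] := belowP hb.
  by rewrite mulmxBl !Lmod_lvec // ee he (lvec_out (below_notin_Lcls hb)) subr0.
rewrite /eps mulE -mulmxA.
suff -> : epsT (fact Lmod) e ^+ #|M| *m lvec e = lvec e by rewrite Lmod_lvec ?ee.
elim: #|M| => [|i IHi]; first by rewrite expr0 mul1mx.
by rewrite exprS mulE -mulmxA IHi.
Qed.

Section HomFrom.
Variables (V : fdmod M k) (modV : is_mod V).

(* The hom sending the generator e of Lmod to eps(e) v. *)
Definition hom_of (v : 'cV[k]_(fdim V)) : 'M[k]_(fdim V, N) :=
  \matrix_(i, j) (fact V (enum_val j) *m (eps (fact V) e *m v)) i 0.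

Lemma hom_of_linear : linear hom_of.
Proof.
move=> a u v; apply/matrixP=> i j.
have E w : hom_of w i j = (fact V (enum_val j) *m (eps (fact V) e *m w)) i 0.
  by rewrite mxE.
rewrite [RHS]mxE [X in _ = X + _]mxE !E !mulmxDr -!scalemxAr.
by rewrite [LHS]mxE [X in X + _ = _]mxE.
Qed.

HB.instance Definition _ := GRing.isLinear.Build k _ _ _ hom_of hom_of_linear.

(** Outside the class both sides vanish, the right one by [rho_eps_out]: this makes [hom_of] well
    defined on the quotient. *)
Lemma hom_of_lvec v n : (n * e)%g = n ->
  hom_of v *m lvec n = fact V n *m (eps (fact V) e *m v).
Proof.
move=> ne; have [nL|nL] := boolP (n \in Lcls e); last first.
  rewrite lvec_out // mulmx0 mulmxA.
  by rewrite -[fact V n *m _]mulE (rho_eps_out HR (proj2 modV)) ?mul0mx.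
rewrite -{1}(enum_rankK_in nL nL) mulmx_lvec; apply/colP=> i.
by rewrite !mxE enum_rankK_in // mxE.
Qed.

Lemma hom_of_hom v : @is_hom M k Lmod V (hom_of v).
Proof.
move=> m; apply: lvec_ext => n /(Lcls_fix ide) ne.
rewrite -mulmxA Lmod_lvec // hom_of_lvec ?mulg_fixl // -(mulmxA (fact V m)).
rewrite hom_of_lvec //.
by rewrite (proj2 modV) mulmxA.
Qed.

Lemma hom_lvec (F : 'M[k]_(fdim V, N)) n : @is_hom M k Lmod V F ->
  (n * e)%g = n -> F *m lvec n = fact V n *m (F *m lvec e).
Proof.
by move=> hF ne; rewrite mulmxA -hF -mulmxA Lmod_lvec ?ne //; exact: eqP ide.
Qed.

Lemma hom_eps (F : 'M[k]_(fdim V, N)) : @is_hom M k Lmod V F ->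
  eps (fact V) e *m (F *m lvec e) = F *m lvec e.
Proof. by move=> hF; rewrite mulmxA -(eps_intertwine _ hF) -mulmxA eps_lvec. Qed.

(** With the full-rank factorization E = CR of [eps], injections in both directions are F -> R F(e)
    and w -> [hom_of (C *m w)]. *)
Lemma homdim_Lmod : homdim Lmod V = \rank (eps (fact V) e).
Proof.
set E := eps (fact V) e; pose C := col_base E; pose R := row_base E.
have EE : E *m E = E by rewrite -mulE (eps_idem HR (proj2 modV)).
have CR : C *m R = E by apply: mulmx_base.
have EC : E *m C = C by apply: mulmx_col_base_idem.
apply/eqP; rewrite eqn_leq; apply/andP; split.
  have := @lin_dim_le k _ _ (mulmx R \o mulmxr (lvec e)) (homsp Lmod V) fullv.
  rewrite dimvf /dim /= muln1; apply=> [|F /(@homspP _ _ Lmod V) hF] /=; first by move=> *; rewrite memvf.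
  move=> RF; have Fe : F *m lvec e = 0.
    by rewrite -(hom_eps hF) -/E -CR -mulmxA RF mulmx0.
  apply: lvec_ext => n /(Lcls_fix ide) ne.
  by rewrite hom_lvec // Fe mulmx0 mul0mx.
have := @lin_dim_le k _ _ (hom_of \o @mulmx _ _ _ 1 C) fullv (homsp Lmod V).
rewrite dimvf /dim /= muln1; apply=> [w _|w _] /=; first exact/(@homspP _ _ Lmod V)/hom_of_hom.
move=> h0; have := hom_of_lvec (C *m w) (eqP ide : (e * e)%g = e).
have eE : fact V e *m E = E by rewrite /E /eps mulE mulmxA -(proj2 modV) (eqP ide).
rewrite h0 mul0mx mulmxA eE mulmxA EC => Cw.
have fC : row_free C^T by rewrite /row_free mxrank_tr; apply: col_base_full.
apply: trmx_inj; apply: (row_free_inj fC).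
by rewrite /= trmx0 mul0mx -trmx_mul -Cw trmx0.
Qed.

End HomFrom.

(** [A] includes the span of the fixed basis vectors and [B] corestricts the action of [x] to it: AB
    = x bounds the rank above, xA = A with A injective bounds it below. *)
Lemma rank_Lmod x : (x * x)%g = x ->
  \rank (fact Lmod x) = #|[set n in Lcls e | x * n == n]%g|.
Proof.
move=> xx; set S := [set n in Lcls e | _].
pose A : 'M[k]_(N, #|S|) := \matrix_(i, j) (enum_val i == enum_val j)%:R.
pose B : 'M[k]_(#|S|, N) := \matrix_(i, j) (enum_val i == x * enum_val j)%g%:R.
have SL n : n \in S -> n \in Lcls e by rewrite inE => /andP[].
have colA j : col j A = lvec (enum_val j) by apply/colP=> i; rewrite !mxE.
have AB : A *m B = fact Lmod x.
  apply: eq_col=> j; rewrite -[RHS]mulmx_lvec Lmod_lvec; last first.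
    by rewrite (Lcls_fix ide) ?enum_valP.
  rewrite col_mulmx; set y := (x * _)%g.
  have [yS|yS] := boolP (y \in S).
    transitivity (col (enum_rank_in yS y) A); last by rewrite colA enum_rankK_in.
    rewrite [RHS]colE; congr (_ *m _); apply/colP=> i; rewrite !mxE andbT.
    by rewrite -(inj_eq enum_val_inj) enum_rankK_in.
  rewrite [col j B](_ : _ = 0) ?mulmx0 ?lvec_out //.
    by apply: contra yS => yL; rewrite inE yL mulgA xx eqxx.
  apply/colP=> i; rewrite !mxE; case: eqP => // iy.
  by move: yS; rewrite /y -iy enum_valP.
have EA : fact Lmod x *m A = A.
  apply: eq_col=> j; rewrite col_mulmx colA.
  have := enum_valP j; rewrite inE => /andP[jL /eqP xj].
  by rewrite Lmod_lvec ?xj // (Lcls_fix ide).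
have A1 : A^T *m A = 1%:M.
  apply: eq_col=> j; rewrite col_mulmx colA -(enum_rankK_in (SL _ (enum_valP j)) (SL _ (enum_valP j))).
  rewrite mulmx_lvec; apply/colP=> i; rewrite !mxE enum_rankK_in ?SL ?enum_valP //.
  by rewrite (inj_eq enum_val_inj) eq_sym.
apply/eqP; rewrite eqn_leq; apply/andP; split.
  by rewrite -AB (leq_trans (mxrankM_maxl _ _)) ?rank_leq_col.
rewrite -[X in (X <= _)%N](mxrank1 k) -A1 (leq_trans (mxrankM_maxr _ _)) //.
by rewrite -EA mxrankM_maxl.
Qed.

Lemma Lmod_projective : projective Lmod.
Proof.
split; first exact: Lmod_is_mod.
move=> V W modV modW f homf surjf g homg.
have [B fB] : exists B, f *m B = 1%:M by apply/row_freeP; rewrite /row_free surjf.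
(* Any preimage of g(e) under f will do: [hom_of] applies [eps] to it, and [eps] fixes g(e). *)
exists (hom_of (B *m (g *m lvec e))); split; first exact: hom_of_hom.
apply: lvec_ext => n /(Lcls_fix ide) ne.
rewrite -mulmxA hom_of_lvec // mulmxA homf -mulmxA.
rewrite (mulmxA f) (eps_intertwine _ homf) -(mulmxA _ f) (mulmxA f) fB mul1mx.
by rewrite hom_eps // -hom_lvec.
Qed.

Lemma Lmod_proj_cover X : ideal2 e = X -> proj_cover (simpleS k X) Lmod.
Proof.
move=> eX; split; first exact: Lmod_projective.
have ee := eqP ide : (e * e)%g = e.
(* The map onto S_X is the character m -> [em = e] restricted to the class. *)
pose pi : 'M[k]_(1, N) := \row_j (e * enum_val j == e)%g%:R.
have piE n : (n * e)%g = n -> pi *m lvec n = (e * n == e)%g%:R%:M.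
  move=> ne; have [nL|nL] := boolP (n \in Lcls e); last first.
    rewrite lvec_out // mulmx0; case: eqP => [en|]; last by rewrite raddf0.
    have [h hb nh] := Lcls_out HR ide ne nL; have [_ ne_h eh _] := belowP hb.
    by rewrite -eh -{1}en -mulgA nh en eqxx in ne_h.
  rewrite -{1}(enum_rankK_in nL nL) mulmx_lvec; apply/colP=> i.
  by rewrite !mxE enum_rankK_in // ord1 eqxx.
have sE m : fact (simpleS k X) m = (e * m == e)%g%:R%:M.
  by rewrite /= -eX (sub_ideal2_omega HR) //; case: ifP.
have hompi : @is_hom M k Lmod (simpleS k X) pi.
  move=> m; apply: lvec_ext => n /(Lcls_fix ide) ne.
  rewrite -!mulmxA Lmod_lvec // !piE ?mulg_fixl // sE -scalar_mxM -natrM mulnb.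
  by rewrite (eq_mulg_fixM HR).
have pie : pi *m lvec e = 1%:M by rewrite piE // ee eqxx.
exists pi; split=> //.
  by apply/eqP; rewrite -[_ == _]/(row_free pi); apply/row_freeP; exists (lvec e).
move=> V modV g homg surjg.
have [w gw] : exists w, pi *m g *m w = 1%:M.
  by apply/row_freeP; rewrite /row_free surjg.
pose im (y : 'cV[k]_N) := exists x, g *m x = y.
have imD y z : im y -> im z -> im (y + z).
  by move=> [u <-] [v <-]; exists (u + v); rewrite mulmxDr.
have imZ a y : im y -> im (a *: y).
  by move=> [u <-]; exists (a *: u); rewrite scalemxAr.
have im0 : im 0 by exists 0; rewrite mulmx0.
have imM m y : im y -> im (fact Lmod m *m y).
  by move=> [u <-]; exists (fact V m *m u); rewrite mulmxA homg mulmxA.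
pose v := g *m w.
have coef1 : \sum_i v i 0 * (e * enum_val i == e)%g%:R = 1.
  transitivity ((pi *m v) 0 0); last by rewrite mulmxA gw mxE.
  by rewrite mxE; apply: eq_bigr => i _; rewrite !mxE mulrC.
have vim : im v by exists w.
(* Acting by n on a vector mapping to 1 in the simple top gives n plus strictly R-smaller terms. *)
have imL n : n \in Lcls e -> im (lvec n).
  have [b] := ubnP (rsize n); elim: b n => // b IHb n lt_n nL.
  have ne := Lcls_fix ide nL.
  have -> : lvec n = fact Lmod n *m v
     - \sum_(i | (e * enum_val i != e)%g) v i 0 *: lvec (n * enum_val i)%g.
    rewrite {1}[v]lvec_sum mulmx_sumr.
    under eq_bigr => i _.
      rewrite -scalemxAr Lmod_lvec; last by rewrite (Lcls_fix ide) ?enum_valP.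
      over.
    rewrite (bigID (fun i => e * enum_val i != e)%g) /= addrAC subrr add0r.
    rewrite -[LHS]scale1r -coef1 (bigID (fun i => e * enum_val i != e)%g) /=.
    rewrite big1 => [|i /negPf->]; last by rewrite mulr0.
    rewrite add0r scaler_suml; apply: eq_bigr => i; rewrite negbK => /eqP ei.
    by rewrite ei eqxx mulr1 -{2}ne -mulgA ei ne.
  apply: (imD _ _); first exact: imM.
  rewrite -scaleN1r; apply: (imZ _ _); apply: (big_ind im im0 imD) => i ei; apply: imZ.
  (* If the product stays in the class, its [rsize] is smaller: an element fixing [n] on the right
     would also fix [e]. *)
  have [niL|/lvec_out-> //] := boolP ((n * enum_val i)%g \in Lcls e).
  apply: IHb => //; apply: leq_trans (rsize_lt HR _) _; last by rewrite -ltnS.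
  by apply: contra ei => /eqP/(Lcls_fix_any HR nL)/eqP.
rewrite /surj -mxrank_tr; apply/eqP; rewrite -[_ == _]/(row_full _).
rewrite -sub1mx; apply/row_subP=> i.
have [x gx] := imL _ (enum_valP i).
apply/submxP; exists x^T; rewrite -trmx_mul gx.
apply/rowP=> j; rewrite !mxE (inj_eq enum_val_inj) eq_sym.
by rewrite -val_eqE.
Qed.

End LtildeModule.

Theorem mainTheorem11 (M : FinMonoid.type) (k : fieldType)
  (HR : rtrivial M)
  (e : {set M} -> M)
  (He : forall X, X \in Lambda M -> idem (e X) /\ ideal2 (e X) = X)
  (P : {set M} -> fdmod M k)
  (HP : forall X, X \in Lambda M -> proj_cover (simpleS k X) (P X))
  (X Y : {set M}) (HX : X \in Lambda M) (HY : Y \in Lambda M) :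
  ((homdim (P X) (P Y))%:Z =
   \sum_(Z in Lambda M | Z \subset X) (mXY e Z Y)%:Z * mobius (Lambda M) Z X)%R.
Proof.
have modPY : is_mod (P Y) by case: (HP _ HY) => -[].
pose c Z : int := (homdim (P Z) (P Y))%:Z%R.
pose g Z : int := (mXY e Z Y)%:Z%R.
(* It remains to show, for every X, that m_(X,Y) is the sum of c_(Z,Y) over Z <= X. *)
apply: (@moebius_inversion _ _ c g _ _ HX) => {HX} {}X HX.
have iso Z (HZ : Z \in Lambda M) := proj_cover_iso (HP _ HZ)
  (Lmod_proj_cover HR k (proj1 (He _ HZ)) (proj2 (He _ HZ))).
have [idX _] := He _ HX; have [idY _] := He _ HY.
(* The rank is computed on k Ltilde_Y and carried to P_Y by uniqueness of the projective cover. *)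
have gE : mXY e X Y = \rank (fact (P Y) (e X)).
  transitivity (\rank (fact (Lmod k (e Y)) (e X))).
    rewrite rank_Lmod //; last exact/eqP.
    by apply: eq_card => n; rewrite !inE.
  have [h [s [homh homs hs sh]]] := iso _ HY.
  by apply/eqP; rewrite eqn_leq (rank_fact_le _ homs sh) (rank_fact_le _ homh hs).
rewrite /g gE (rank_eps_sum HR He (proj1 modPY) (proj2 modPY) HX).
rewrite (big_morph Posz PoszD (erefl _)); apply: eq_bigr => Z /andP[HZ _].
have [idZ _] := He _ HZ.
rewrite /c -(homdim_Lmod HR idZ modPY); congr Posz.
have [h [s [homh homs hs sh]]] := iso _ HZ.
by apply/eqP; rewrite eqn_leq (homdim_le _ homs sh) (homdim_le _ homh hs).
Qed.
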